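(* Let $d \ge 1$ be an integer. Every $d$-dimensional $2$-level polytope $P$ satisfies $f_0(P)\, f_{d-1}(P) \le d\, 2^{d+1}$.
   Context: A polytope is the convex hull of a finite set of points in a Euclidean space; its dimension is the dimension of its affine hull. A polytope $P$ is called $2$-level if for every facet-defining hyperplane $H$ of $P$ there is a hyperplane $H'$ parallel to $H$ such that $H \cup H'$ contains all vertices of $P$. (For a $d$-dimensional polytope one may take the ambient space to be $\mathbb{R}^d$.) $f_0(P)$ denotes the number of vertices of $P$, and $f_{d-1}(P)$ denotes the number of facets (that is, $(d-1)$-dimensional faces) of $P$. *)

(* Defs.v *)
From HB Require Import structures.
From mathcomp Require Import all_boot all_order all_algebra finmap.
From mathcomp Require Import boolp classical_sets functions cardinality reals.

Set Implicit Arguments.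
Unset Strict Implicit.
Unset Printing Implicit Defensive.

Import Order.TTheory GRing.Theory Num.Theory.
Local Open Scope classical_set_scope.
Local Open Scope ring_scope.

Section Polytopes.
Variables (R : realType) (n : nat).
Implicit Types (a x v : 'rV[R]_n) (b : R) (A F P S : set 'rV[R]_n).

Definition dot a x : R := \sum_i a 0 i * x 0 i.

Definition aff_hull A : set 'rV[R]_n :=
  [set x | exists k (w : 'I_k -> R) (p : 'I_k -> 'rV[R]_n),
    [/\ forall i, A (p i), \sum_i w i = 1 & x = \sum_i w i *: p i]].

Definition conv_hull A : set 'rV[R]_n :=
  [set x | exists k (w : 'I_k -> R) (p : 'I_k -> 'rV[R]_n),
    [/\ forall i, A (p i), forall i, 0 <= w i, \sum_i w i = 1
      & x = \sum_i w i *: p i]].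

(* The affine hull is a translate of a k-dimensional linear subspace; the
   empty set has no dimension in this sense. *)
Definition has_dim A (k : nat) : Prop :=
  exists p (U : {vspace 'rV[R]_n}),
    \dim U = k /\ aff_hull A = [set x | x - p \in U].

Definition polytope P : Prop := exists2 S, finite_set S & P = conv_hull S.

(* A genuine hyperplane only when a != 0. *)
Definition hyperplane a b : set 'rV[R]_n := [set x | dot a x = b].

Definition halfspace a b : set 'rV[R]_n := [set x | dot a x <= b].

(* Taking a = 0 makes P itself and the empty set faces of P. *)
Definition face P F : Prop :=
  exists a b, P `<=` halfspace a b /\ F = P `&` hyperplane a b.

Definition faces (k : nat) P : set (set 'rV[R]_n) :=
  [set F | face P F /\ has_dim F k].

Definition facet P F : Prop := exists2 k, has_dim P k.+1 & faces k P F.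

Definition vertices P : set 'rV[R]_n := [set v | face P [set v]].

(* Two hyperplanes are parallel when they admit a common normal vector a. *)
Definition two_level P : Prop :=
  forall a b, a != 0 -> facet P (P `&` hyperplane a b) ->
    exists b', vertices P `<=` hyperplane a b `|` hyperplane a b'.

(* fset_set sends an infinite set to fset0; the lemmas finite_vertices and
   finite_faces below rule this out for polytopes. *)
Definition num_vertices P : nat := #|` fset_set (vertices P)|.

Definition num_faces (k : nat) P : nat := #|` fset_set (faces k P)|.

Lemma dot_sum a k (w : 'I_k -> R) (p : 'I_k -> 'rV[R]_n) :
  dot a (\sum_i w i *: p i) = \sum_i w i * dot a (p i).
Proof.
rewrite /dot; under [RHS]eq_bigr do rewrite mulr_sumr.
rewrite exchange_big /=; apply: eq_bigr => j _.
rewrite summxE mulr_sumr; apply: eq_bigr => i _.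
by rewrite mxE mulrCA.
Qed.

Lemma sub_conv_hull A : A `<=` conv_hull A.
Proof.
move=> x Ax; exists 1%N, (fun=> 1), (fun=> x).
by split=> //; rewrite big_ord1 ?scale1r.
Qed.

Lemma face_conv_hull S F : face (conv_hull S) F -> F = conv_hull (S `&` F).
Proof.
move=> [a [b [Pab FE]]]; apply/seteqP; split=> x.
- rewrite FE => -[[k [w [p [Sp w0 w1 xE]]]] axb].
  have apb i : dot a (p i) <= b by apply: Pab; exact: sub_conv_hull.
  have tight i : w i != 0 -> dot a (p i) = b.
    move=> wi0; apply/eqP; rewrite eq_sym -subr_eq0.
    have : \sum_i w i * (b - dot a (p i)) = 0.
      under eq_bigr do rewrite mulrBr.
      by rewrite sumrB -mulr_suml w1 mul1r -dot_sum -xE axb subrr.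
    move/psumr_eq0P => /(_ _ i isT) /eqP; rewrite mulf_eq0 (negPf wi0); apply.
    by move=> j _; rewrite mulr_ge0// subr_ge0.
  have [i0 wi0] : exists i0, w i0 != 0.
    apply/existsP; apply: contra_eqT w1 => /existsPn w_eq0.
    rewrite big1 => [|i _]; first by rewrite eq_sym oner_eq0.
    by apply/eqP; have := w_eq0 i; rewrite negbK.
  exists k, w, (fun i => if w i == 0 then p i0 else p i); split=> //.
    move=> i; have [_|wi] := eqVneq (w i) 0; split=> //.
    by split; [exact: sub_conv_hull|exact: tight].
    by split; [exact: sub_conv_hull|exact: tight].
  by rewrite xE; apply: eq_bigr => i _; case: eqP => // ->; rewrite !scale0r.
- move=> [k [w [p [SFp w0 w1 xE]]]]; rewrite FE; split.
    by exists k, w, p; split=> // i; case: (SFp i).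
  rewrite /hyperplane /= xE dot_sum.
  transitivity (\sum_i w i * b); last by rewrite -mulr_suml w1 mul1r.
  by apply: eq_bigr => i _; have [_] := SFp i; rewrite FE => -[_ ->].
Qed.

Lemma finite_face P : polytope P -> finite_set [set F | face P F].
Proof.
move=> [S Sfin ->].
apply: (@sub_finite_set _ _
  ((fun X : {fset 'rV[R]_n} => conv_hull [set` X]) @`
   [set` fpowerset (fset_set S)])); last exact/finite_image/finite_fset.
move=> F /face_conv_hull FE.
have fSF : finite_set (S `&` F) by exact: finite_setIl.
exists (fset_set (S `&` F)); last by rewrite fset_setK// -FE.
by rewrite /= fpowersetE -fset_set_sub//; exact: subIsetl.
Qed.

Lemma finite_faces P k : polytope P -> finite_set (faces k P).
Proof. by move=> /finite_face; apply: sub_finite_set => F []. Qed.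

Lemma finite_vertices P : polytope P -> finite_set (vertices P).
Proof.
move=> [S Sfin ->]; apply: sub_finite_set Sfin => v /face_conv_hull vE.
have : [set v] v by [].
rewrite {1}vE => -[[|k] [w [p [Sp _ w1 _]]]].
  by move/eqP: w1; rewrite big_ord0 eq_sym oner_eq0.
by have [Sv <-] := Sp ord0.
Qed.

End Polytopes.

(* Main.v *)
Require Import Defs.
From mathcomp Require Import all_boot all_order all_algebra.
From mathcomp Require Import boolp zify ring lra.

Set Implicit Arguments.
Unset Strict Implicit.
Unset Printing Implicit Defensive.

(* Following Kupavskii and Weltge.  Homogenize, so that affine functionals on a
   d-dimensional P become linear forms on points of rank D = d + 1, and let
   B(S), in the code [patterns p S], be the family of subsets of the vertex set
   S of a 2-level polytope whose indicator is the restriction of a linear form.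
   Then |S| |B(S)| <= D 2^D, by induction on D.  Take a facet with vertex set
   Z such that |Z| >= |Y|, where Y = S \ Z; one exists, for otherwise the
   reflection of P in the barycenter of S would lie in the interior of P.  Two
   members of B(S) with the same trace on Z differ by Y, so |B(S)| = q + s,
   where q <= |B(Z)| and s <= q counts the W in B(S) disjoint from Y
   with W + Y in B(S).  The induction hypothesis bounds |Z| q by
   (D - 1) 2^(D-1).  If k is the rank of Y, then 2 |Y| <= 2^k and s <= 2^(D-k),
   because these count cube vertices in subspaces of dimension k and D - k.
   As (|Z| - |Y|) (q - s) >= 0,
   |S| |B(S)| = (|Z| + |Y|) (q + s) <= 2 (|Z| q + |Y| s) <= D 2^D.
   Finally Z' |-> Z \ Z' is injective on the vertex sets of facets of P, with
   values in B(Z), so P has at most |B(Z)| facets, while |S| <= 2 |Z|. *)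

Import Order.TTheory GRing.Theory Num.Theory.
Local Open Scope ring_scope.

(** * Counting two-valued vectors by rank *)

(** Some [\rank M] coordinates span all the others, so a member of [A] is determined by its values
    there, each being [a] or [b]; [h] records these choices. *)
Lemma card_two_valued (K : fieldType) (I J : finType) (A : {set J})
    (F : J -> I -> K) (a b : K) :
    (forall j i, j \in A -> F j i = a \/ F j i = b) ->
    {in A &, forall j j', F j =1 F j' -> j = j'} ->
  (#|A| <= 2 ^ \rank (\matrix_(i < #|A|, j < #|I|)
                        F (enum_val i) (enum_val j)))%N.
Proof.
move=> Fab Finj; set M := (\matrix_(i, j) _).
rewrite -mxrank_tr; have := eq_maxrowsub M^T; move: (maxrankfun _) => g gM.
have /submxP[D MD] : (M^T <= rowsub g M^T)%MS by rewrite gM.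
pose h j := [ffun k : 'I_(\rank M^T) => F j (enum_val (g k)) == a].
have h_inj : {in A &, injective h}.
  move=> j j' jA j'A /ffunP hE; apply: Finj => // i.
  have FE k : F j (enum_val (g k)) = F j' (enum_val (g k)).
    have := hE k; rewrite !ffunE.
    case: (Fab j (enum_val (g k)) jA) => ->;
      case: (Fab j' (enum_val (g k)) j'A) => -> //; rewrite eqxx.
      by move/esym/eqP.
    by move/eqP.
  have FM j0 (j0A : j0 \in A) i0 :
      F j0 (enum_val i0) = M^T i0 (enum_rank_in j0A j0).
    by rewrite !mxE enum_rankK_in.
  rewrite -(enum_rankK i) (FM j jA) (FM j' j'A) MD !mxE.
  by apply: eq_bigr => k _; rewrite ![rowsub _ _ _ _]mxE -!FM FE.
apply: leq_trans (_ : #|[set h j | j in A]| <= _)%N.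
  by rewrite (card_in_imset h_inj).
by rewrite (leq_trans (max_card _))// card_ffun card_bool card_ord.
Qed.

Lemma signed_bit (K : realFieldType) (b c : bool) :
  (-1) ^+ b * (2 * c%:R - 1) = (-1) ^+ (b (+) ~~ c) :> K.
Proof. by case: b c => -[] /=; rewrite ?expr0 ?expr1; lra. Qed.

(** * Linear forms, spans and ranks of a finite point configuration *)

Section PointConfiguration.
Variables (R : realFieldType) (T : finType) (N : nat) (p : T -> 'rV[R]_N).
Implicit Types (S X Y Z W : {set T}) (f g h : 'cV[R]_N) (t : T).

Definition ev f t : R := (p t *m f) 0 0.

Lemma evD f g t : ev (f + g) t = ev f t + ev g t.
Proof. by rewrite /ev mulmxDr mxE. Qed.

Lemma evZ c f t : ev (c *: f) t = c * ev f t.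
Proof. by rewrite /ev -scalemxAr mxE. Qed.

Lemma evB f g t : ev (f - g) t = ev f t - ev g t.
Proof. by rewrite /ev mulmxBr !mxE. Qed.

Lemma evN f t : ev (- f) t = - ev f t.
Proof. by rewrite /ev mulmxN mxE. Qed.

Definition sp S := (\sum_(t in S) <<p t>>)%MS.
Definition rk S := \rank (sp S).
Definition zeros S f := [set t in S | ev f t == 0].
Definition nonneg S f := forall t, t \in S -> 0 <= ev f t.
Definition vanish S f := forall t, t \in S -> ev f t = 0.

Lemma sp_subP S m (M : 'M_(m, N)) :
  reflect (forall t, t \in S -> (p t <= M)%MS) (sp S <= M)%MS.
Proof.
apply: (iffP sumsmx_subP) => sM t tS; first by rewrite -(genmxE (p t)) sM.
by rewrite genmxE sM.
Qed.

Lemma mem_sp S t : t \in S -> (p t <= sp S)%MS.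
Proof. by move: t; apply/sp_subP. Qed.

Lemma sp_mono Z S : Z \subset S -> (sp Z <= sp S)%MS.
Proof. by move=> /subsetP ZS; apply/sp_subP => t /ZS /mem_sp. Qed.

Lemma rk_mono Z S : Z \subset S -> (rk Z <= rk S)%N.
Proof. by move=> /sp_mono/mxrankS. Qed.

Lemma vanish_spP S f : reflect (vanish S f) (sp S <= kermx f)%MS.
Proof.
apply: (iffP (sp_subP _ _)) => v t tS.
  by rewrite /ev; move/sub_kermxP: (v t tS) => ->; rewrite mxE.
apply/sub_kermxP/rowP => i; rewrite (ord1 i) [RHS]mxE; exact: v.
Qed.

Lemma vanish_sub Z S f : (sp S <= sp Z)%MS -> vanish Z f -> vanish S f.
Proof. by move=> SZ /vanish_spP vZ; apply/vanish_spP/(submx_trans SZ). Qed.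

Lemma vanish_zeros S f : vanish (zeros S f) f.
Proof. by move=> t; rewrite inE => /andP[_ /eqP]. Qed.

Lemma zeros_sub S f : zeros S f \subset S.
Proof. by apply/subsetP => t; rewrite inE => /andP[]. Qed.

Lemma separating Z t :
  ~~ (p t <= sp Z)%MS -> exists2 f, vanish Z f & ev f t != 0.
Proof.
move=> tZ; have := tZ; rewrite submxE => /rV0Pn[j].
have := @submxE _ 1 _ _ _ (sp Z); move: (cokermx _) => C spE Ctj.
have evC u : ev (col j C) u = (p u *m C) 0 j.
  by rewrite /ev colE mulmxA -colE mxE.
exists (col j C) => [u /mem_sp|]; last by rewrite evC.
by rewrite evC spE => /eqP ->; rewrite mxE.
Qed.

Lemma rkU1 Z t : (rk (t |: Z) <= (rk Z).+1)%N.
Proof.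
have sub : (sp (t |: Z) <= p t + sp Z)%MS.
  apply/sp_subP => u /setU1P[->|uZ]; first exact: addsmxSl.
  by apply: submx_trans (addsmxSr _ _); exact: mem_sp.
rewrite (leq_trans (mxrankS sub))//.
rewrite (leq_trans (mxrank_adds_leqif _ _).1)//.
exact: (leq_add (rank_leq_row (p t)) (leqnn (rk Z))).
Qed.

Lemma vanish_eq Z S f : Z \subset S -> (rk S <= rk Z)%N ->
  vanish Z f -> vanish S f.
Proof.
move=> ZS rkSZ; apply: vanish_sub.
by rewrite -(geq_leqif (mxrank_leqif_sup (sp_mono ZS))).
Qed.

(** The span of [Z] has codimension one in that of [S], so a form vanishing on [Z] is determined on
    [S] by its value at one point [t] off that span. *)
Lemma proportional Z S g f t : Z \subset S -> rk S = (rk Z).+1 ->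
    t \in S -> ev g t != 0 -> vanish Z g -> vanish Z f ->
  {in S, forall u, ev f u = ev f t / ev g t * ev g u}.
Proof.
move=> ZS rkSE tS gt0 gZ fZ u uS.
pose h := f - (ev f t / ev g t) *: g.
have hv : vanish (t |: Z) h.
  move=> v /setU1P[->|vZ]; rewrite evB evZ; first by rewrite divfK ?subrr.
  by rewrite (gZ v vZ) (fZ v vZ) mulr0 subrr.
have ntZ : ~~ (p t <= sp Z)%MS.
  apply: contra gt0 => tZ; apply/eqP.
  apply: (@vanish_sub Z [set t]) gZ _ _; last by rewrite set11.
  by apply/sp_subP => v /set1P ->.
have tZS : t |: Z \subset S by rewrite subUset sub1set tS.
have lt : (rk Z < rk (t |: Z))%N.
  rewrite ltn_neqAle rk_mono ?subsetUr ?andbT//.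
  apply: contra ntZ => /eqP rkE.
  apply: submx_trans (mem_sp (setU11 t Z)) _.
  rewrite -(geq_leqif (mxrank_leqif_sup (sp_mono (subsetUr _ _)))).
  exact: eq_leq (esym rkE).
apply/eqP; rewrite -subr_eq0 -evZ -evB; apply/eqP.
by apply: (vanish_eq tZS) uS; rewrite ?rkSE.
Qed.

(** * The cone of nonnegative forms and its generators *)

(** Ratio test: [s] is the least [ev f t / ev h t] over points with [ev h t > 0], and the minimizer
    becomes a new zero. The second hypothesis gives [s > 0]. *)
Lemma push_to_boundary S f h : nonneg S f ->
    (forall t, t \in S -> ev f t = 0 -> ev h t <= 0) ->
    (exists2 t, t \in S & 0 < ev h t) ->
  exists s, [/\ 0 < s, nonneg S (f - s *: h)
    & exists t, [/\ t \in S, ev f t != 0 & ev (f - s *: h) t = 0]].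
Proof.
move=> fS hZ [t0 t0S ht0].
have := @Order.TotalTheory.arg_minP _ R T t0
  [pred t | (t \in S) && (0 < ev h t)] (fun t => ev f t / ev h t).
rewrite /= t0S ht0 => /(_ isT)[t /andP[tS ht] tmin].
have ft : ev f t != 0 by apply: contraTneq ht => /(hZ _ tS); rewrite leNgt.
exists (ev f t / ev h t); split.
- by rewrite divr_gt0// lt_def ft fS.
- move=> u uS; rewrite evB evZ subr_ge0.
  have [hu|hu] := ltP 0 (ev h u).
    by rewrite -ler_pdivlMr//; apply: tmin; apply/andP.
  apply: le_trans (fS u uS); rewrite mulr_ge0_le0//.
  by rewrite divr_ge0 ?fS// ltW.
- by exists t; split; rewrite // evB evZ divfK ?subrr// gt_eqF.
Qed.

Definition facet_form S f := nonneg S f /\ rk S = (rk (zeros S f)).+1.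

(** Facet forms generate the cone of nonnegative forms, up to forms vanishing on [S]. Induction on
    the number of nonzero values: any other form is a positive combination of two nonnegative forms
    with more zeros. *)
Lemma cone_ind S (Q : 'cV[R]_N -> Prop) :
    (forall f, vanish S f -> Q f) ->
    (forall f g, Q f -> Q g -> Q (f + g)) ->
    (forall c f, 0 < c -> Q f -> Q (c *: f)) ->
    (forall f, facet_form S f -> Q f) ->
  forall f, nonneg S f -> Q f.
Proof.
move=> Q0 QD QZ QF f.
have [m] := ubnP #|S :\: zeros S f|; elim: m => // m IH in f *.
rewrite ltnS => fm fS.
have step g : nonneg S g -> vanish (zeros S f) g ->
    (exists t, [/\ t \in S, ev f t != 0 & ev g t = 0]) -> Q g.
  move=> gS gZ [t [tS ft gt]]; apply: IH => //; apply: leq_trans fm.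
  apply: proper_card; apply/properP; split.
    apply/subsetP => u; rewrite !inE => /andP[+ uS]; rewrite uS !andbT /=.
    by apply: contraNneq => fu; rewrite gZ// inE uS fu eqxx.
  by exists t; rewrite !inE tS ?ft ?gt ?eqxx.
have [/forall_inP v|/forall_inPn[t0 t0S ft0]] :=
    boolP [forall (t | t \in S), ev f t == 0].
  by apply: Q0 => t /v/eqP.
have ltZ : (rk (zeros S f) < rk S)%N.
  rewrite ltnNge; apply: contra ft0 => le; apply/eqP.
  by apply: (vanish_eq (zeros_sub S f) le) t0S; exact: vanish_zeros.
have [rkE|rkE] := eqVneq (rk S) (rk (zeros S f)).+1; first exact: QF.
(* The zeros of [f] have rank at most [rk S - 2], so together with [t0] they still do not span. *)
have [t1 t1S nt1] : exists2 t1, t1 \in S & ~~ (p t1 <= sp (t0 |: zeros S f))%MS.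
  apply/exists_inP/contraT => /exists_inPn all_in.
  have : (sp S <= sp (t0 |: zeros S f))%MS.
    by apply/sp_subP => t /all_in; rewrite negbK.
  move/mxrankS; rewrite -/(rk _) -/(rk _).
  by have := rkU1 (zeros S f) t0; move: rkE ltZ; lia.
have [h hZ ht1] : exists2 h, vanish (t0 |: zeros S f) h & 0 < ev h t1.
  have [h hZ ht1] := separating nt1.
  have [ht1'|ht1'] := ltP 0 (ev h t1); first by exists h.
  exists (- h) => [t tZ|]; first by rewrite evN hZ// oppr0.
  by rewrite evN oppr_gt0 lt_neqAle ht1.
have hZ' t : t \in S -> ev f t = 0 -> ev h t = 0.
  by move=> tS ft; rewrite hZ// !inE tS ft eqxx orbT.
have [t tS /(hZ' t tS) -> //||s [s0 uS u0]] := @push_to_boundary S f h fS.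
  by exists t1.
set u := f - s *: h in uS u0.
have uZ : vanish (zeros S f) u.
  move=> t; rewrite inE => /andP[tS /eqP ft].
  by rewrite evB evZ ft hZ'// mulr0 subrr.
(* As [u] stays positive at [t0], [f] can in turn be pushed along [u], which gives
   [f = (f - s' *: u) + s' *: u]. *)
have ut0 : 0 < ev u t0.
  by rewrite evB evZ hZ ?setU11// mulr0 subr0 lt_def ft0 fS.
have [||s' [s'0 vS v0]] := @push_to_boundary S f u fS.
- by move=> t tS ft; rewrite uZ// inE tS ft eqxx.
- by exists t0.
rewrite -(subrK (s' *: u) f); apply: QD.
  apply: step => // t tZ; rewrite evB evZ uZ// (vanish_zeros tZ).
  by rewrite mulr0 subrr.
by apply: QZ => //; exact: step.
Qed.

(** * Two-level configurations on the hyperplane where [e] is 1 *)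

Variables (e : 'cV[R]_N) (ev_e : forall t, ev e t = 1).
Hypothesis p_inj : injective p.

Definition two_level_points S := forall f, facet_form S f ->
  exists c, forall t, t \in S -> ev f t = 0 \/ ev f t = c.

Definition patterns S : {set {set T}} :=
  [set X in powerset S |
    `[< exists f, forall t, t \in S -> ev f t = (t \in X)%:R >]].

Lemma patternsP S X : reflect
  (X \subset S /\ exists f, forall t, t \in S -> ev f t = (t \in X)%:R)
  (X \in patterns S).
Proof. by rewrite !inE; apply: (iffP andP) => -[? /asboolP]. Qed.

Lemma facet_form_support S f :
  facet_form S f -> exists2 t, t \in S & 0 < ev f t.
Proof.
move=> [fS rkE]; have [/forall_inP v|/forall_inPn[t tS ft]] :=
    boolP [forall (t | t \in S), ev f t == 0].
  suff SE : zeros S f = S by move: rkE; rewrite SE; lia.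
  by apply/setP => t; rewrite inE; apply/andb_idr/v.
by exists t; rewrite // lt_def ft fS.
Qed.

Lemma binary_facet S f : two_level_points S -> facet_form S f ->
  exists2 c, 0 < c & forall t, t \in S -> ev f t = c * (t \notin zeros S f)%:R.
Proof.
move=> S2 fF; have [c fc] := S2 f fF.
have [t0 t0S ft0] := facet_form_support fF; exists (ev f t0) => // t tS.
have cE : ev f t0 = c.
  by case: (fc t0 t0S) => // ft0E; rewrite ft0E ltxx in ft0.
rewrite inE tS /=; have [->|ft] := eqVneq (ev f t) 0; first by rewrite mulr0.
by rewrite mulr1 cE; case: (fc t tS) => // /eqP; rewrite (negPf ft).
Qed.

Lemma facet_pattern S f : two_level_points S -> facet_form S f ->
  S :\: zeros S f \in patterns S.
Proof.
move=> S2 fF; have [c c0 fc] := binary_facet S2 fF.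
apply/patternsP; split; first exact: subsetDl.
exists (c^-1 *: f) => t tS.
by rewrite evZ fc// mulKf ?gt_eqF// in_setD tS andbT.
Qed.

(** Only the zeros of [g] constrain [f]: elsewhere a large multiple of [g] outweighs it. *)
Lemma nonneg_shift S f g : (forall t, t \in S -> ev g t = 0 -> 0 <= ev f t) ->
  nonneg S g -> exists2 c, 0 <= c & nonneg S (f + c *: g).
Proof.
move=> fg gS; pose c := \sum_(t in S) `|ev f t / ev g t|.
have c0 : 0 <= c by apply: sumr_ge0.
exists c => // t tS; rewrite evD evZ.
have [gt0|gt0] := eqVneq (ev g t) 0; first by rewrite gt0 mulr0 addr0 fg.
have gtp : 0 < ev g t by rewrite lt_def gt0 gS.
rewrite -[X in X + _](divfK gt0) -mulrDl mulr_ge0 ?gS// addrC -lerBlDr sub0r.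
apply: (@le_trans _ _ `|ev f t / ev g t|); first by rewrite lerNl lerNnormlW.
by rewrite /c (bigD1 t)//= lerDl sumr_ge0.
Qed.

(** A facet form [g] of the facet [Z] becomes nonnegative on [S] after adding a multiple of [f],
    which is 0 on [Z]. One of the facet forms generating the result is nonzero on [Z]; there it is
    proportional to [g], so its two values carry over. *)
Lemma facet_two_level S f : two_level_points S -> facet_form S f ->
  two_level_points (zeros S f).
Proof.
move=> S2 fF g [gZ rkg]; set Z := zeros S f in gZ rkg *.
have [t0 t0Z gt0] := facet_form_support (conj gZ rkg).
have [t tS ft0|c c0 gS] := @nonneg_shift S g f _ fF.1.
  by apply: gZ; rewrite inE tS ft0 eqxx.
have gE t : t \in Z -> ev (g + c *: f) t = ev g t.
  by move=> tZ; rewrite evD evZ (vanish_zeros tZ) mulr0 addr0.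
have ZS : Z \subset S := zeros_sub S f.
have [h hF [hv [t1 t1Z ht1]]] : exists2 h, facet_form S h &
    (forall t, t \in S -> ev (g + c *: f) t = 0 -> ev h t = 0) /\
    exists2 t, t \in Z & ev h t != 0.
  (* Nonnegativity is part of [Q] because it makes a zero of [u + v] a zero of both [u] and [v]. *)
  pose Q u := nonneg S u /\ ((exists2 t, t \in Z & 0 < ev u t) ->
    exists2 h, facet_form S h & (forall t, t \in S -> ev u t = 0 -> ev h t = 0)
      /\ exists2 t, t \in Z & ev h t != 0).
  have QP : forall u, nonneg S u -> Q u.
    apply: cone_ind => [u uv|u v [uS Qu] [vS Qv]|b u b0 [uS Qu]|u uF].
    - split=> [t /uv -> //|[t /(subsetP ZS)/uv ->]]; by rewrite ltxx.
    - split=> [t tS|[t tZ]]; first by rewrite evD addr_ge0 ?uS ?vS.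
      have tS := subsetP ZS _ tZ; rewrite evD => uvt.
      have uvE s : s \in S -> ev (u + v) s = 0 -> ev u s = 0 /\ ev v s = 0.
        move=> sS /eqP; rewrite evD paddr_eq0 ?uS ?vS//.
        by move=> /andP[/eqP ? /eqP].
      have [ut|ut] := ltP 0 (ev u t).
        have [|h hF [hv ht]] := Qu; first by exists t.
        by exists h => //; split=> // s sS /(uvE s sS)[us _]; exact: hv.
      have [|h hF [hv ht]] := Qv; first by exists t => //; lra.
      by exists h => //; split=> // s sS /(uvE s sS)[_ vs]; exact: hv.
    - split=> [t tS|[t tZ]]; first by rewrite evZ mulr_ge0 ?uS ?ltW.
      rewrite evZ pmulr_rgt0// => ut.
      have [|h hF [hv ht]] := Qu; first by exists t.
      exists h => //; split=> // s sS /eqP.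
      by rewrite evZ mulf_eq0 gt_eqF//= => /eqP; exact: hv.
    - split=> [|[t tZ ut]]; first exact: uF.1.
      by exists u => //; split=> //; exists t; rewrite // gt_eqF.
  by apply: (QP _ gS).2; exists t0; rewrite ?gE.
have hgE : {in Z, forall u, ev h u = ev h t0 / ev g t0 * ev g u}.
  apply: (@proportional (zeros Z g)) => //.
  - exact: zeros_sub.
  - by rewrite gt_eqF.
  - exact: vanish_zeros.
  - move=> t tZg; have tZ : t \in Z := subsetP (zeros_sub Z g) _ tZg.
    by apply: hv; [exact: (subsetP ZS)|rewrite gE// (vanish_zeros tZg)].
set b := _ / _ in hgE.
have b0 : b != 0 by apply: contraNneq ht1 => b0; rewrite hgE// b0 mul0r.
have [c' hc'] := S2 h hF; exists (c' / b) => t tZ.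
have [] := hc' t (subsetP ZS _ tZ); rewrite hgE//.
  by move/eqP; rewrite mulf_eq0 (negPf b0)/= => /eqP; left.
by right; apply: (mulfI b0); rewrite [RHS]mulrC divfK.
Qed.

Lemma ev_inj t u : (forall f, ev f t = ev f u) -> t = u.
Proof.
move=> tu; apply/p_inj/rowP => i; have := tu (delta_mx i 0).
by rewrite /ev -!colE !mxE.
Qed.

(** Supports of facet forms are patterns, so facet forms, and with them all nonnegative forms, agree
    at [t] and [u]. Adding a multiple of [e] makes any form nonnegative. *)
Lemma pattern_separation S t u : two_level_points S -> t \in S -> u \in S ->
  (forall X, X \in patterns S -> (t \in X) = (u \in X)) -> t = u.
Proof.
move=> S2 tS uS tu.
have evE f : nonneg S f -> ev f t = ev f u.
  apply: (cone_ind (Q := fun f => ev f t = ev f u)) f => [f fv|f g|c f|f fF].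
  - by rewrite !fv.
  - by rewrite !evD => -> ->.
  - by rewrite !evZ => _ ->.
  - have [c _ fc] := binary_facet S2 fF; rewrite !fc//.
    by have := tu _ (facet_pattern S2 fF); rewrite !in_setD tS uS !andbT => ->.
apply: ev_inj => f; have [v _|v _|c _] := @nonneg_shift S f e.
- by rewrite ev_e => /eqP; rewrite oner_eq0.
- by rewrite ev_e ler01.
by move/evE; rewrite !evD !evZ !ev_e => /addIr.
Qed.

Lemma sum_indicator S (P : pred T) :
  \sum_(t in S) (P t)%:R = #|[set t in S | P t]|%:R :> R.
Proof.
rewrite -sum1_card natr_sum [RHS](eq_bigl (fun t => (t \in S) && P t)).
  by rewrite big_mkcondr /=; apply: eq_bigr => t _; case: (P t).
by move=> t; rewrite inE.
Qed.

Lemma card_zeros S f :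
  (#|zeros S f| + #|[set t in S | t \notin zeros S f]|)%N = #|S|.
Proof.
rewrite -[RHS](cardsID (zeros S f)) (setIidPr (zeros_sub S f)).
by congr (_ + #|pred_of_set _|)%N; apply/setP => t; rewrite !inE andbC.
Qed.

(* If every facet missed more than half of the points, then the reflection of
   any point through the barycenter would satisfy all facet inequalities
   strictly; reflecting a point of a facet contradicts the opposite level. *)
Lemma large_facet S : two_level_points S -> (1 < rk S)%N ->
  exists2 f, facet_form S f & (#|S| <= 2 * #|zeros S f|)%N.
Proof.
move=> S2 rkS; apply: contrapT => /forall2NP noF.
have noF' f : facet_form S f -> (2 * #|zeros S f| < #|S|)%N.
  by move=> fF; case: (noF f) => // /negP; rewrite -ltnNge.
have [v vS] : exists v, v \in S.
  apply/set0Pn; apply: contraTneq rkS => ->.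
  by rewrite /rk /sp big_set0 mxrank0.
(* This says that [f] is nonnegative at twice the barycenter minus [p u]. *)
have half f : nonneg S f ->
    forall u, u \in S -> #|S|%:R * ev f u <= 2 * \sum_(t in S) ev f t.
  apply: (cone_ind (Q := fun f => forall u, u \in S ->
    #|S|%:R * ev f u <= 2 * \sum_(t in S) ev f t)) f
    => [f fv|f g Qf Qg|c f c0 Qf|f fF] u uS.
  - by rewrite fv// big1 ?mulr0.
  - rewrite evD; under eq_bigr do rewrite evD.
    by rewrite big_split !mulrDr lerD ?Qf ?Qg.
  - rewrite evZ; under eq_bigr do rewrite evZ.
    by rewrite -mulr_sumr mulrCA [leRHS]mulrCA ler_pM2l ?Qf.
  - have [c c0 fc] := binary_facet S2 fF; rewrite fc// (eq_bigr _ fc).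
    rewrite -mulr_sumr sum_indicator mulrCA [leRHS]mulrCA ler_pM2l//.
    rewrite -!natrM ler_nat; have := card_zeros S f; have := noF' f fF.
    by case: (_ \notin _); lia.
have [f fF] : exists f, facet_form S f.
  apply: contrapT => noff.
  have vS0 : forall f, nonneg S f -> vanish S f.
    apply: cone_ind => [//|f g fv gv|c f _ fv|f fF].
    - by move=> t tS; rewrite evD fv ?gv ?addr0.
    - by move=> t tS; rewrite evZ fv ?mulr0.
    - by case: noff; exists f.
  suff : ev e v = 0 by apply/eqP; rewrite ev_e oner_eq0.
  by apply: (vS0 e) vS => t _; rewrite ev_e ler01.
have [c c0 fc] := binary_facet S2 fF.
have [u uZ] : exists u, u \in zeros S f.
  apply/set0Pn; apply: contraTneq rkS => Z0.
  by rewrite fF.2 Z0 /rk /sp big_set0 mxrank0.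
have uS : u \in S := subsetP (zeros_sub S f) _ uZ.
(* The opposite level: this form is [c] on the zeros of [f] and 0 elsewhere on [S], so [half] at the
   zero [u] yields [#|S| <= 2 * #|zeros S f|]. *)
have gE t : t \in S -> ev (c *: e - f) t = c * (t \in zeros S f)%:R.
  by move=> tS; rewrite evB evZ ev_e fc//; case: (t \in _) => /=; lra.
have gS : nonneg S (c *: e - f).
  by move=> t tS; rewrite gE// mulr_ge0 ?ler0n// ltW.
have := half _ gS u uS.
rewrite gE// uZ (eq_bigr _ gE) -mulr_sumr sum_indicator.
rewrite mulrCA [leRHS]mulrCA ler_pM2l// -!natrM ler_nat muln1.
have -> : [set t in S | t \in zeros S f] = zeros S f.
  by apply/setP => t; rewrite !inE andbA andbb.
by have := noF' f fF; lia.
Qed.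


(** * Counting points and patterns *)

Lemma patterns_restrict Z S X : Z \subset S ->
  X \in patterns S -> X :&: Z \in patterns Z.
Proof.
move=> /subsetP ZS /patternsP[XS [f fX]]; apply/patternsP.
split; first exact: subsetIr.
by exists f => t tZ; rewrite fX ?ZS// inE tZ andbT.
Qed.

(** The forms realizing [X] and [X'] differ on [S] by a multiple of [f], hence by a constant off the
    facet. A nonzero constant difference of 0/1 values leaves only 1 against 0, or 0 against 1,
    throughout. *)
Lemma pattern_fiber S f X X' : two_level_points S -> facet_form S f ->
    X \in patterns S -> X' \in patterns S ->
    X :&: zeros S f = X' :&: zeros S f -> X != X' ->
  exists b : bool, forall t, t \in S :\: zeros S f ->
    (t \in X) = b /\ (t \in X') = ~~ b.
Proof.
move=> S2 fF /patternsP[XS [g gX]] /patternsP[X'S [g' g'X']] XX'Z XX'.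
have [c c0 fc] := binary_facet S2 fF.
have XX'Zt t : t \in zeros S f -> (t \in X) = (t \in X').
  by move=> tZ; move/setP/(_ t): XX'Z; rewrite !in_setI tZ !andbT.
have [t tY XX't] : exists2 t, t \in S :\: zeros S f & (t \in X) != (t \in X').
  apply/exists_inP; apply: contraR XX' => /exists_inPn XX'Y.
  apply/eqP/setP => t.
  have [tZ|tZ] := boolP (t \in zeros S f); first exact: XX'Zt.
  have [tS|tS] := boolP (t \in S).
    by have := XX'Y t; rewrite inE tZ tS negbK => /(_ isT)/eqP.
  by rewrite (contraNF (subsetP XS t) tS) (contraNF (subsetP X'S t) tS).
have := tY; rewrite in_setD => /andP[tZ tS].
have prop := @proportional (zeros S f) S f (g - g') t (zeros_sub S f)
  fF.2 tS.
exists (t \in X) => u; rewrite in_setD => /andP[uZ uS].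
have : ev (g - g') u = ev (g - g') t.
  rewrite prop//.
  - by rewrite !fc// tZ uZ mulr1 divfK// gt_eqF.
  - by rewrite fc// tZ mulr1 gt_eqF.
  - exact: vanish_zeros.
  - move=> v vZ; have vS := subsetP (zeros_sub S f) _ vZ.
    by rewrite evB gX// g'X'// XX'Zt// subrr.
rewrite !evB !gX// !g'X'//; move: XX't; clear.
by case: (u \in X) (u \in X') (t \in X) (t \in X') => -[] [] [] //= _; lra.
Qed.

(** Distinct patterns with the same trace on [Z] are some [W] disjoint from [Y] and [W :|: Y]. [D]
    collects the lower members of these pairs: without them restriction to [Z] is injective, and
    adding [Y] sends [D] into the remaining patterns. *)
Lemma card_patterns_split S f (Z := zeros S f) (Y := S :\: Z)
    (D := [set W in patterns S |
            (W :&: Y == set0) && (W :|: Y \in patterns S)]) :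
    two_level_points S -> facet_form S f ->
  (#|patterns S :\: D| <= #|patterns Z|)%N /\ (#|D| <= #|patterns S :\: D|)%N.
Proof.
move=> S2 fF; have ZS : Z \subset S := zeros_sub S f.
have [t0 t0Y] : exists t, t \in Y.
  have [t tS ft] := facet_form_support fF; exists t.
  by rewrite in_setD tS inE tS gt_eqF.
split.
  have res_inj : {in patterns S :\: D &, injective (fun X => X :&: Z)}.
    have aux X X' : X \in patterns S -> X' \in patterns S :\: D ->
        X :&: Z = X' :&: Z ->
        (forall t, t \in Y -> (t \in X) = true /\ (t \in X') = false) -> False.
      move=> XS; rewrite in_setD => /andP[/negP X'D X'S] XX'Z XX'Y; apply: X'D.
      rewrite inE X'S /=; apply/andP; split.
        rewrite -subset0; apply/subsetP => t; rewrite in_setI => /andP[tX' tY].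
        by have [_] := XX'Y t tY; rewrite tX'.
      suff -> : X' :|: Y = X by [].
      apply/setP => t; rewrite in_setU; have [tY|tY] := boolP (t \in Y).
        by rewrite orbT (XX'Y t tY).1.
      rewrite orbF; have [tS|tS] := boolP (t \in S).
        have tZ : t \in Z by move: tY; rewrite in_setD tS andbT negbK.
        by move/setP/(_ t): XX'Z; rewrite !in_setI tZ !andbT.
      have /patternsP[/subsetP XsS _] := XS.
      have /patternsP[/subsetP X'sS _] := X'S.
      by rewrite (contraNF (XsS t) tS) (contraNF (X'sS t) tS).
    move=> X X' XD X'D XX'; have [//|nXX'] := eqVneq X X'; exfalso.
    have XS : X \in patterns S by move: XD; rewrite in_setD => /andP[].
    have X'S : X' \in patterns S by move: X'D; rewrite in_setD => /andP[].
    have [[] bY] := pattern_fiber S2 fF XS X'S XX' nXX'.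
      exact: aux XX' bY.
    by apply: (aux X' X) => // t /bY[].
  rewrite -(card_in_imset res_inj) subset_leq_card//.
  apply/subsetP => _ /imsetP[X XD ->]; apply: patterns_restrict ZS _.
  by move: XD; rewrite in_setD => /andP[].
have add_inj : {in D &, injective (fun W => W :|: Y)}.
  move=> W W'; rewrite !inE => /andP[_ /andP[/eqP WY _]].
  move=> /andP[_ /andP[/eqP W'Y _]] /setP WW'; apply/setP => t.
  have := WW' t; rewrite !in_setU; have [tY _|_] := boolP (t \in Y).
    move/setP/(_ t): WY; move/setP/(_ t): W'Y.
    by rewrite !in_setI tY !andbT in_set0 => -> ->.
  by rewrite !orbF.
rewrite -(card_in_imset add_inj) subset_leq_card//.
apply/subsetP => _ /imsetP[W + ->]; rewrite inE => /andP[_ /andP[_ WYS]].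
rewrite in_setD WYS andbT inE; apply/negP => /andP[_ /andP[/eqP/setP/(_ t0)]].
by rewrite in_setI in_setU t0Y orbT in_set0.
Qed.

(* The [2 * #|Y|] signed vectors [+-(2 X - 1)], with [X] ranging over the
   patterns of [S], are pairwise distinct vertices of a cube and lie in a
   linear image of the span of [Y]. *)
Lemma card_points_bound S Y : two_level_points S -> Y \subset S ->
  (2 * #|Y| <= 2 ^ rk Y)%N.
Proof.
move=> S2 /subsetP YS.
(* Sets that are not patterns get the form [e], so that their columns also have entries 1 or -1. *)
have [Phi PhiE] : exists Phi : {set T} -> 'cV[R]_N, forall X t, t \in S ->
    ev (Phi X) t = if X \in patterns S then 2 * (t \in X)%:R - 1 else 1.
  apply: (@fin_all_exists _ (fun=> 'cV[R]_N) (fun X f => forall t, t \in S ->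
    ev f t = if X \in patterns S then 2 * (t \in X)%:R - 1 else 1)) => X.
  have [/patternsP[_ [f fX]]|_] := boolP (X \in patterns S); last by exists e.
  by exists (2 *: f - e) => t tS; rewrite evB evZ fX// ev_e.
pose F (y : T * bool) X : R := (-1) ^+ y.2 *
  (if X \in patterns S then 2 * (y.1 \in X)%:R - 1 else 1).
have FE y b X : X \in patterns S ->
    F (y, b) X = (-1) ^+ (b (+) (y \notin X)).
  by move=> XS; rewrite /F /= XS signed_bit.
have -> : (2 * #|Y|)%N = #|setX Y [set: bool]|.
  by rewrite cardsX cardsT card_bool mulnC.
have := @card_two_valued R {set T} _ (setX Y [set: bool]) F 1 (-1).
set M := (\matrix_(i, j) _) => count; apply: leq_trans (count _ _) _.
- move=> [y b] X _; have [/FE ->|nX] := boolP (X \in patterns S).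
    by case: (_ (+) _); rewrite ?expr0 ?expr1; auto.
  by rewrite /F (negPf nX) mulr1; case: b; rewrite ?expr0 ?expr1; auto.
(* The column of the pattern [S] reads off the sign; the other patterns then separate the points. *)
- have ST : S \in patterns S.
    by apply/patternsP; split=> //; exists e => t tS; rewrite ev_e tS.
  move=> [y b] [y' b']; rewrite !in_setX /= !in_setT !andbT.
  move=> /YS yS /YS y'S FF.
  have bb' : b = b'.
    by have := FF S; rewrite !FE// yS y'S => /signr_inj; rewrite !addbF.
  congr (_, _) => //; apply: (pattern_separation S2) => // X XS.
  by have := FF X; rewrite !FE// bb' => /signr_inj/addbI/negb_inj.
- rewrite leq_exp2l//.
  have enumY (i : 'I_#|setX Y [set: bool]|) : (enum_val i).1 \in Y.
    have := enum_valP i.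
    by case: (enum_val i) => y b; rewrite in_setX => /andP[].
  pose U := \matrix_(i < #|setX Y [set: bool]|)
    ((-1) ^+ (enum_val i).2 *: p (enum_val i).1).
  pose G := \matrix_(k < N, j < #|{set T}|) Phi (enum_val j) k 0.
  have -> : M = U *m G.
    apply/matrixP => i j; rewrite mxE /F.
    rewrite -PhiE ?YS// -evZ /ev mxE [RHS]mxE; apply: eq_bigr => k _.
    by rewrite !mxE mulrCA mulrA.
  rewrite (leq_trans (mxrankM_maxl _ _))// mxrankS//.
  apply/row_subP => i; rewrite rowK scalemx_sub// mem_sp// enumY.
Qed.

(** Forms realizing members of [D] vanish on the span of [Y], so the matrix of their values on [S]
    has rank at most [rk S - rk Y]. *)
Lemma card_patterns_bound S Y (D : {set {set T}}) : Y \subset S ->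
    D \subset patterns S -> (forall W, W \in D -> W :&: Y = set0) ->
  (#|D| <= 2 ^ (rk S - rk Y))%N.
Proof.
move=> YS /subsetP DS DY.
have [Phi PhiE] : exists Phi : {set T} -> 'cV[R]_N, forall W t, W \in D ->
    t \in S -> ev (Phi W) t = (t \in W)%:R.
  apply: (@fin_all_exists _ (fun=> 'cV[R]_N) (fun W f =>
    forall t, W \in D -> t \in S -> ev f t = (t \in W)%:R)) => W.
  have [/DS/patternsP[_ [f fW]]|_] := boolP (W \in D); last by exists 0.
  by exists f => t _; exact: fW.
have := @card_two_valued R T _ D (fun W t => (t \in W)%:R) 0 1.
set M := (\matrix_(i, j) _) => count; apply: leq_trans (count _ _) _.
- by move=> W t _; case: (t \in W); auto.
- move=> W W' _ _ WW'; apply/setP => t; have /eqP := WW' t.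
  case: (t \in W) (t \in W') => -[] //=; first by rewrite oner_eq0.
  by rewrite eq_sym oner_eq0.
rewrite leq_exp2l// -mxrank_tr.
pose U := \matrix_(i < #|T|) (if enum_val i \in S then p (enum_val i) else 0).
pose G := \matrix_(k < N, j < #|D|) Phi (enum_val j) k 0.
have -> : M^T = U *m G.
  apply/matrixP => i j; rewrite !mxE.
  have WD := enum_valP j; have [iS|iS] := boolP (enum_val i \in S).
    rewrite -PhiE// /ev mxE; apply: eq_bigr => k _.
    by rewrite !mxE iS.
  have /patternsP[/subsetP WS _] := DS _ WD.
  rewrite (contraNF (WS _) iS) big1// => k _.
  by rewrite !mxE (negPf iS) mxE mul0r.
have Ui t : t \in S -> (p t <= U)%MS.
  move=> tS; have -> : p t = row (enum_rank t) U by rewrite rowK enum_rankK tS.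
  exact: row_sub.
have rkU : \rank U = rk S.
  apply/eqP; rewrite eqn_leq; apply/andP; split; apply: mxrankS.
    apply/row_subP => i; rewrite rowK; case: ifP => [iS|_]; first exact: mem_sp.
    exact: sub0mx.
  exact/sp_subP.
have : (rk Y <= \rank (U :&: kermx G)%MS)%N.
  apply: mxrankS; apply/sp_subP => t tY.
  rewrite sub_capmx Ui ?(subsetP YS)//=; apply/sub_kermxP/rowP => j.
  rewrite [RHS]mxE; have WD := enum_valP j.
  have := DY _ WD => /setP/(_ t); rewrite in_setI tY andbT in_set0 => tW.
  have := PhiE _ t WD (subsetP YS _ tY); rewrite tW /ev mxE => PE.
  by rewrite mxE -[RHS]PE; apply: eq_bigr => k _; rewrite !mxE.
by rewrite -rkU -(mxrank_mul_ker U G) => rkY; rewrite -addnBA// leq_addr.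
Qed.

Theorem two_level_points_bound S : two_level_points S ->
  (#|S| * #|patterns S| <= rk S * 2 ^ rk S)%N.
Proof.
have [m] := ubnP (rk S); elim: m => // m IH in S *; rewrite ltnS => rkm S2.
(* In rank at most 1 all forms are proportional to [e] on [S], so [S] has at most one point and the
   power set bound suffices. *)
have [rkS|rkS] := leqP (rk S) 1.
  have cardS : (#|S| <= rk S)%N.
    have [->|[t tS]] := set_0Vmem S; first by rewrite cards0.
    have rk0 : rk set0 = 0%N by rewrite /rk /sp big_set0 mxrank0.
    have rk1 : rk S = 1%N.
      apply/eqP; rewrite eqn_leq rkS /= lt0n; apply/eqP => rkS0.
      have : vanish S e.
        by apply: (vanish_eq (sub0set S)) => [|u]; rewrite ?rkS0// inE.
      by move/(_ t tS)/eqP; rewrite ev_e oner_eq0.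
    rewrite rk1; apply/card_le1_eqP => u v uS vS; apply: ev_inj => f.
    rewrite (@proportional set0 S e f u (sub0set S) _ uS _ _ _ v vS).
    - by rewrite !ev_e divr1 mulr1.
    - by rewrite rk0 rk1.
    - by rewrite ev_e oner_eq0.
    - by move=> ?; rewrite inE.
    - by move=> ?; rewrite inE.
  apply: leq_mul => //; apply: (@leq_trans #|powerset S|).
    by apply/subset_leq_card/subsetP => X /patternsP[XS _]; rewrite inE.
  by rewrite card_powerset leq_exp2l.
have [f fF card_half] := large_facet S2 rkS.
have [leZ leD] := card_patterns_split S2 fF.
have ZS := zeros_sub S f.
move: leZ leD; set Z := zeros S f in ZS card_half *; set Y := S :\: Z.
set D := [set W in _ | _] => leZ leD.
have cardZY : (#|Z| + #|Y| = #|S|)%N by rewrite -(cardsID Z S) (setIidPr ZS).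
have DS : D \subset patterns S by apply/subsetP => W; rewrite inE => /andP[].
have cardD : (#|D| + #|patterns S :\: D| = #|patterns S|)%N.
  by rewrite -(cardsID D (patterns S)) (setIidPr DS).
have YS : Y \subset S by exact: subsetDl.
have bY := card_points_bound S2 YS.
have bD : (#|D| <= 2 ^ (rk S - rk Y))%N.
  by apply: card_patterns_bound => // W; rewrite inE => /andP[_ /andP[/eqP]].
have bYD : (2 * #|Y| * #|D| <= 2 ^ rk S)%N.
  by rewrite (leq_trans (leq_mul bY bD))// -expnD subnKC// rk_mono.
have rkE : rk S = (rk Z).+1 by exact: fF.2.
have bZ : (#|Z| * #|patterns Z| <= rk Z * 2 ^ rk Z)%N.
  by apply: IH (facet_two_level S2 fF); rewrite -ltnS -rkE.
have bZ' : (#|Z| * #|patterns S :\: D| <= rk Z * 2 ^ rk Z)%N.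
  by apply: leq_trans bZ; rewrite leq_mul2l leZ orbT.
have leY : (#|Y| <= #|Z|)%N by move: card_half; rewrite -cardZY; lia.
rewrite -cardZY -cardD; move: bYD bZ'; rewrite rkE expnS.
move: leD leY; move: #|Y| #|Z| #|D| #|_ :\: D| (2 ^ rk Z)%N (rk Z).
move=> r q s k b a sk rq rs_le qk_le.
(* This is [(q - r) * (k - s) >= 0], with [q], [r] the sizes of [Z], [Y] and [k], [s] those of
   [patterns S :\: D], [D]. *)
have : ((r * k + q * s) <= q * k + r * s)%N by nia.
by nia.
Qed.


(** * Counting facets *)

Definition facet_sets (S : {set T}) : {set {set T}} :=
  [set Z | `[< exists2 f, facet_form S f & Z = zeros S f >]].

Theorem facet_sets_bound (S : {set T}) d : two_level_points S ->
    rk S = d.+1 -> (0 < d)%N ->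
  (#|S| * #|facet_sets S| <= d * 2 ^ d.+1)%N.
Proof.
move=> S2 rkS d0; have rkS1 : (1 < rk S)%N by rewrite rkS.
have [f fF card_half] := large_facet S2 rkS1.
have ZS : zeros S f \subset S := zeros_sub S f.
have rkZ : rk (zeros S f) = d by move: fF.2; rewrite rkS => -[].
suff le : (#|facet_sets S| <= #|patterns (zeros S f)|)%N.
  have := two_level_points_bound (facet_two_level S2 fF).
  rewrite rkZ expnS => bZ; apply: leq_trans (leq_mul card_half le) _.
  by rewrite -mulnA [in leqRHS]mulnCA leq_mul2l.
have facetP Z' : Z' \in facet_sets S ->
    exists2 g, facet_form S g & Z' = zeros S g.
  by rewrite inE => /asboolP.
have facet_patternI Z' : Z' \in facet_sets S -> S :\: Z' \in patterns S.
  by move=> /facetP[g gF ->]; exact: facet_pattern.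
have restrE Z' : (S :\: Z') :&: zeros S f = zeros S f :\: Z'.
  by rewrite setIDAC (setIidPr ZS).
(* Here [Z1] lies in the facet [zeros S f], and equal ranks make [g1] vanish on all of it. The
   common trace is then empty, so [g2] vanishes on the whole of [S], which no facet form does. *)
have aux Z1 Z2 : Z1 \in facet_sets S -> Z2 \in facet_sets S ->
    zeros S f :\: Z1 = zeros S f :\: Z2 ->
    (forall t, t \in S :\: zeros S f ->
       (t \in S :\: Z1) = true /\ (t \in S :\: Z2) = false) -> False.
  move=> /facetP[g1 g1F ->] /facetP[g2 g2F ->] /setP Z12 fib.
  have Z1Z : zeros S g1 \subset zeros S f.
    apply/subsetP => t tZ1; apply/negPn/negP => tZ.
    have tS := subsetP (zeros_sub S g1) _ tZ1.
    have [] := fib t; first by rewrite in_setD tZ.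
    by rewrite in_setD tZ1.
  have g1Z : vanish (zeros S f) g1.
    apply: (vanish_eq Z1Z); last exact: vanish_zeros.
    by rewrite -ltnS -g1F.2 fF.2.
  have [t tS gt0] := facet_form_support g2F.
  suff : t \in zeros S g2 by move/vanish_zeros; lra.
  have [tZ|tZ] := boolP (t \in zeros S f).
    have := Z12 t; rewrite !in_setD tZ !andbT => /negb_inj <-.
    by rewrite inE tS g1Z ?eqxx.
  have [] := fib t; first by rewrite in_setD tZ.
  by rewrite !in_setD tS !andbT => _ /negbFE.
have inj : {in facet_sets S &, injective (fun Z' => zeros S f :\: Z')}.
  move=> Z1 Z2 Z1F Z2F Z12.
  have ZE Z' : Z' \in facet_sets S -> S :\: (S :\: Z') = Z'.
    move=> /facetP[g _ ->]; rewrite setDDr setDv set0U.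
    exact/setIidPr/zeros_sub.
  have [E|nE] := eqVneq (S :\: Z1) (S :\: Z2); first by rewrite -(ZE Z1)// E ZE.
  exfalso; have restr12 : (S :\: Z1) :&: zeros S f = (S :\: Z2) :&: zeros S f.
    by rewrite !restrE.
  have [[] fib] := pattern_fiber S2 fF (facet_patternI Z1 Z1F)
    (facet_patternI Z2 Z2F) restr12 nE.
    exact: (aux Z1 Z2).
  by apply: (aux Z2 Z1) => // t /fib[].
rewrite -(card_in_imset inj) subset_leq_card//.
apply/subsetP => X /imsetP[Z' Z'F ->]; rewrite -restrE.
exact: patterns_restrict ZS (facet_patternI Z' Z'F).
Qed.

End PointConfiguration.

(** * The Farkas lemma for finitely many generators *)

(** Induction on the number of generators. If the form separating [q] from the other generators is
    negative at [p ord0], the induction hypothesis is applied again after projecting along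
    [p ord0]. *)
Lemma farkas (R : realFieldType) (N k : nat) (p : 'I_k -> 'rV[R]_N)
    (q : 'rV[R]_N) :
  (exists2 c : 'I_k -> R, forall i, 0 <= c i & q = \sum_i c i *: p i) \/
  (exists2 f : 'cV[R]_N, forall i, 0 <= (p i *m f) 0 0 & (q *m f) 0 0 < 0).
Proof.
elim: k => [|k IH] in p q *.
  have [->|/rV0Pn[j qj]] := eqVneq q 0.
    by left; exists (fun=> 0) => [i|]; rewrite ?big_ord0.
  right; exists (- q 0 j *: delta_mx j 0) => [[]//|].
  rewrite -scalemxAr -colE !mxE mulNr oppr_lt0 -expr2.
  by rewrite lt_def sqrf_eq0 qj sqr_ge0.
have [[c c0 qE]|[f f0 fq]] := IH (fun i => p (lift ord0 i)) q.
  left; exists (fun i => if unlift ord0 i is Some j then c j else 0).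
    by move=> i; case: unliftP.
  rewrite big_ord_recl unlift_none scale0r add0r qE.
  by apply: eq_bigr => i _; rewrite liftK.
have [fp|fp] := leP 0 ((p ord0 *m f) 0 0).
  right; exists f => // i; case: (unliftP ord0 i) => [j ->|->] //; exact: f0.
set b := (p ord0 *m f) 0 0 in fp.
(* Project along [p ord0] onto the kernel of [f]. *)
pose pr (v : 'rV[R]_N) := v - ((v *m f) 0 0 / b) *: p ord0.
have [[c c0 qE]|[g g0 gq]] := IH (fun i => pr (p (lift ord0 i))) (pr q).
  (* [c'] is the coefficient of [p ord0] left after undoing the projections; it is nonnegative as
     [f] is negative at [q] and [p ord0] but not at the other generators. *)
  left; pose c' := (q *m f) 0 0 / b
    - \sum_i c i * ((p (lift ord0 i) *m f) 0 0 / b).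
  exists (fun i => if unlift ord0 i is Some j then c j else c').
    move=> i; case: unliftP => // _; rewrite /c' subr_ge0.
    apply: (@le_trans _ _ 0).
      apply: sumr_le0 => j _; rewrite mulr_ge0_le0// mulr_ge0_le0 ?f0//.
      by rewrite invr_le0 ltW.
    by rewrite mulr_le0// ?invr_le0 ltW.
  rewrite big_ord_recl unlift_none.
  rewrite -[LHS](subrK (((q *m f) 0 0 / b) *: p ord0)) -/(pr q) qE.
  under [in RHS]eq_bigr do rewrite liftK.
  rewrite /pr; under [in LHS]eq_bigr do rewrite scalerBr scalerA.
  rewrite sumrB -scaler_suml /c' scalerBl.
  by rewrite addrAC -addrA addrC addrAC.
have prf v : (v *m (g - ((p ord0 *m g) 0 0 / b) *: f)) 0 0 = (pr v *m g) 0 0.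
  rewrite mulmxBr -scalemxAr mulmxBl -scalemxAl.
  rewrite [LHS]mxE [X in _ + X]mxE [X in _ - X]mxE.
  rewrite [RHS]mxE [X in _ = _ + X]mxE [X in _ = _ - X]mxE.
  by ring.
right; exists (g - ((p ord0 *m g) 0 0 / b) *: f); last by rewrite prf.
move=> i; rewrite prf; case: (unliftP ord0 i) => [j ->|->]; first exact: g0.
by rewrite /pr divff ?lt_eqF// scale1r subrr mul0mx mxE.
Qed.

From mathcomp Require Import finmap classical_sets cardinality reals.

Local Open Scope classical_set_scope.

(** * Homogenization and convex hulls of finite sets *)

Section Geometry.
Variables (R : realType) (n : nat).
Implicit Types (a x y v : 'rV[R]_n) (b : R) (A F P : set 'rV[R]_n).

Definition homog x : 'rV[R]_(n + 1) := row_mx x 1%:M.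

Definition aff_form a b : 'cV[R]_(n + 1) := col_mx (- a^T) b%:M.

Lemma homog_aff_form a b x : (homog x *m aff_form a b) 0 0 = b - dot a x.
Proof.
rewrite mul_row_col mul1mx mulmxN mxE [X in X + _]mxE [X in _ + X]mxE mulr1n.
rewrite [X in - X]mxE addrC; congr (_ - _); apply: eq_bigr => i _.
by rewrite mxE mulrC.
Qed.

Lemma aff_formE (f : 'cV[R]_(n + 1)) : exists a b, f = aff_form a b.
Proof.
exists (- (usubmx f)^T), (dsubmx f 0 0); rewrite -[LHS]vsubmxK /aff_form.
by rewrite linearN /= trmxK opprK -mx11_scalar.
Qed.

Lemma homog_inj : injective homog.
Proof. by move=> x y /eq_row_mx[]. Qed.

Lemma homog_affine (k : nat) (w : 'I_k -> R) (q : 'I_k -> 'rV[R]_n) :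
  \sum_i w i = 1 -> homog (\sum_i w i *: q i) = \sum_i w i *: homog (q i).
Proof.
move=> w1; rewrite /homog; apply/rowP => j; rewrite summxE.
case: (splitP j) => i /= ij.
  have -> : j = lshift 1 i by exact: val_inj.
  rewrite row_mxEl summxE; apply: eq_bigr => l _.
  by rewrite mxE [RHS]mxE row_mxEl.
have -> : j = rshift n i by exact: val_inj.
rewrite row_mxEr !mxE (ord1 i) mulr1n -[LHS]w1; apply: eq_bigr => l _.
by rewrite mxE row_mxEr mxE mulr1n mulr1.
Qed.

Lemma homog_comb (k : nat) (w : 'I_k -> R) (q : 'I_k -> 'rV[R]_n) x :
  homog x = \sum_i w i *: homog (q i) ->
  \sum_i w i = 1 /\ x = \sum_i w i *: q i.
Proof.
rewrite /homog => xE; split.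
  have /(congr1 (fun v : 'rV_(n + 1) => v 0 (rshift n 0))) := xE.
  rewrite row_mxEr mxE mulr1n summxE => ->; apply: eq_bigr => i _.
  by rewrite mxE row_mxEr mxE mulr1n mulr1.
apply/rowP => j.
have /(congr1 (fun v : 'rV_(n + 1) => v 0 (lshift 1 j))) := xE.
rewrite row_mxEl !summxE => ->; apply: eq_bigr => i _.
by rewrite mxE [RHS]mxE row_mxEl.
Qed.

Lemma conv_hull_halfspace A a b :
  A `<=` halfspace a b -> conv_hull A `<=` halfspace a b.
Proof.
move=> Ab x [k [w [q [Aq w0 w1 ->]]]]; rewrite /halfspace /= dot_sum.
rewrite -[leRHS]mul1r -w1 mulr_suml; apply: ler_sum => i _.
by rewrite ler_wpM2l//; exact: Ab.
Qed.

(** Farkas for homogenized points: the last coordinate makes the coefficients sum to 1, while a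
    separating form is an affine inequality valid on [X] and violated by [x]. *)
Lemma mem_conv_hull (X : {fset 'rV[R]_n}) x :
  (forall a b, [set` X] `<=` halfspace a b -> halfspace a b x) ->
  conv_hull [set` X] x.
Proof.
move=> Xx; pose q (i : 'I_(size (enum_fset X))) := nth 0 (enum_fset X) i.
have [[c c0 /homog_comb[c1 xE]]|[f f0 fx]] :=
  farkas (fun i => homog (q i)) (homog x).
  exists (size (enum_fset X)), c, q; split=> // i.
  exact: (mem_nth 0 (ltn_ord i)).
have [a [b fE]] := aff_formE f; move: f0 fx; rewrite fE => f0.
rewrite homog_aff_form subr_lt0 ltNge; case/negP; apply: Xx => y /= yX.
have iy : (index y (enum_fset X) < size (enum_fset X))%N by rewrite index_mem.
by have := f0 (Ordinal iy); rewrite homog_aff_form subr_ge0 /q nth_index.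
Qed.

Lemma vertices_sub P : vertices P `<=` P.
Proof.
move=> v [a [b [_ vE]]]; have : [set v] v by [].
by rewrite {1}vE => -[].
Qed.

(** A generator [s] that is not a vertex can be discarded: a halfspace containing all generators
    except [s] would make [s] the unique maximizer of a functional over the hull, hence a vertex. *)
Lemma conv_hull_vertices P : polytope P -> conv_hull (vertices P) = P.
Proof.
move=> [S Sfin PE].
have {S Sfin PE} [X PE] : exists X : {fset 'rV[R]_n}, P = conv_hull [set` X].
  by exists (fset_set S); rewrite fset_setK.
have [m] := ubnP #|` X|; elim: m => // m IH in X PE *; rewrite ltnS => Xm.
have [XV|] := pselect ([set` X] `<=` vertices P).
  apply/seteqP; split=> x.
    move=> [k [w [q [Vq w0 w1 ->]]]].
    rewrite PE; apply: mem_conv_hull => a b Xab.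
    apply: (@conv_hull_halfspace (vertices P)); last by exists k, w, q.
    move=> v /vertices_sub; rewrite PE; exact: conv_hull_halfspace.
  rewrite {1}PE => -[k [w [q [Xq w0 w1 ->]]]]; exists k, w, q; split=> // i.
  exact: XV.
move=> /existsNP[s /not_implyP[sX nVs]].
apply: (IH (X `\ s)%fset); last first.
  apply: leq_trans Xm; have := cardfsD1 s X; rewrite (_ : s \in X)//.
  by move=> ->.
have in_halfspace a b : [set` (X `\ s)%fset] `<=` halfspace a b ->
    [set` X] `<=` halfspace a b.
  move=> Xsab y yX; have [->|ys] := eqVneq y s; last first.
    by apply: Xsab; rewrite /= !inE ys.
  rewrite /halfspace /= leNgt; apply/negP => sb; apply: nVs.
  have Xas : [set` X] `<=` halfspace a (dot a s).
    move=> z zX; have [->|zs] := eqVneq z s; first by rewrite /halfspace /=.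
    apply/ltW/(le_lt_trans _ sb); apply: Xsab.
    by rewrite /= !inE zs.
  exists a, (dot a s); split; first by rewrite PE; exact: conv_hull_halfspace.
  have Fface : face (conv_hull [set` X])
      (conv_hull [set` X] `&` hyperplane a (dot a s)).
    by exists a, (dot a s); split=> //; exact: conv_hull_halfspace.
  rewrite PE; apply/seteqP; split=> [_ ->|x].
    by split=> //; exact: sub_conv_hull.
  rewrite (face_conv_hull Fface) => -[k [w [q [Fq w0 w1 ->]]]] /=.
  suff qs i : q i = s.
    by under eq_bigr do rewrite qs; rewrite -scaler_suml w1 scale1r.
  have [qX [_ qF]] := Fq i; apply/eqP; apply: contraT => nqs.
  have : dot a (q i) <= b by apply: Xsab; rewrite /= !inE nqs.
  by rewrite qF leNgt sb.
rewrite PE; apply/seteqP; split=> x Xx; apply: mem_conv_hull => a b.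
  by move=> /in_halfspace Xab; exact: conv_hull_halfspace Xab _ Xx.
move=> Xab; apply: conv_hull_halfspace Xx => y /=.
by rewrite !inE => /andP[_]; exact: Xab.
Qed.

End Geometry.

(** * Dimension as rank *)

Section Dimension.
Variables (R : realType) (n : nat) (V : {fset 'rV[R]_n}).

Definition hpt (t : V) : 'rV[R]_(n + 1) := homog (val t).

Definition pts (A : {set V}) : set 'rV[R]_n :=
  [set x | exists2 t, t \in A & x = val t].

Lemma hpt_inj : injective hpt.
Proof. by move=> t u /homog_inj/val_inj. Qed.

Lemma ev_hpt a b t : ev hpt (aff_form a b) t = b - dot a (val t).
Proof. exact: homog_aff_form. Qed.

Lemma ev_hpt1 t : ev hpt (aff_form 0 1) t = 1.
Proof. by rewrite ev_hpt /dot big1 ?subr0// => i _; rewrite mxE mul0r. Qed.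

Lemma aff_hull_conv_hull (A : {set V}) y :
  aff_hull (conv_hull (pts A)) y <-> (homog y <= sp hpt A)%MS.
Proof.
split=> [[k [w [q [qA w1 ->]]]]|].
  rewrite homog_affine//; apply: summx_sub => i _; apply: scalemx_sub.
  have [k' [w' [q' [q'A _ w'1 ->]]]] := qA i.
  rewrite homog_affine//; apply: summx_sub => j _; apply: scalemx_sub.
  by have [t tA ->] := q'A j; exact: (mem_sp hpt tA).
move=> /sub_sumsmxP[u uE].
have cP t : exists c : R, (u t *m <<hpt t>>)%MS = c *: hpt t.
  have /sub_rVP[c cE] : (u t *m <<hpt t>>%MS <= hpt t)%MS.
    by rewrite -(genmxE (hpt t)) submxMl.
  by exists c.
have [c cE] := fin_all_exists cP.
have : homog y = \sum_(i < #|A|) c (enum_val i) *: homog (val (enum_val i)).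
  rewrite uE (eq_bigr (fun t => c t *: hpt t)) => [|t _]; last exact: cE.
  by rewrite [LHS]big_enum_val.
move=> /homog_comb[c1 yE].
exists #|A|, (c \o enum_val), (val \o enum_val); split=> // i.
by apply: sub_conv_hull; exists (enum_val i) => //; exact: enum_valP.
Qed.

(** The vectors of the span killed by [e] are the directions of the affine hull with a 0 appended;
    they have codimension one in the span. *)
Lemma has_dim_conv_hull (A : {set V}) k :
  rk hpt A = k.+1 -> has_dim (conv_hull (pts A)) k.
Proof.
move=> rkA; have [A0|[t0 t0A]] := set_0Vmem A.
  by move: rkA; rewrite A0 /rk /sp big_set0 mxrank0.
pose e : 'cV[R]_(n + 1) := aff_form 0 1.
pose pr : 'M[R]_(n + 1, n) := col_mx 1%:M 0.
pose inj : 'M[R]_(n, n + 1) := row_mx 1%:M 0.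
pose K := (sp hpt A :&: kermx e)%MS.
have row0E (x : 'rV[R]_n) : row_mx x 0 = x *m inj.
  by rewrite mul_mx_row mulmx1 mulmx0.
have rkK : \rank K = k.
  have := mxrank_mul_ker (sp hpt A) e; rewrite -/K -[RHS]/(rk hpt A) rkA.
  suff -> : \rank (sp hpt A *m e) = 1%N by rewrite add1n => -[].
  apply/eqP; rewrite eqn_leq rank_leq_col lt0n mxrank_eq0 /=.
  apply/negP => /eqP/sub_kermxP/vanish_spP/(_ t0 t0A)/eqP.
  by rewrite ev_hpt1 oner_eq0.
have Ke : K *m e = 0 by apply/sub_kermxP; exact: capmxSr.
have KE : K *m pr *m inj = K.
  have : K *m (pr *m inj + e *m row_mx 0 1%:M) = K.
    rewrite (_ : pr *m inj + e *m row_mx 0 1%:M = 1%:M) ?mulmx1//.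
    rewrite /pr /inj /e /aff_form !mul_col_row !mulmx0 !mul0mx !mulmx1.
    rewrite add_block_mx.
    by rewrite trmx0 oppr0 !(add0r, addr0, mul0mx, mulmx0) -scalar_mx_block.
  by rewrite mulmxDr !mulmxA Ke mul0mx addr0.
have rkKpr : \rank (K *m pr) = k.
  by rewrite -rkK; apply/eqP; rewrite eqn_leq mxrankM_maxl -{1}KE mxrankM_maxl.
(* [has_dim] asks for a [vspace], so the row space of [K *m pr] is presented as the image of an
   injective linear map. *)
have [M ME Mfree] : exists2 M : 'M[R]_(k, n), (M :=: K *m pr)%MS & row_free M.
  rewrite -rkKpr; exists (row_base (K *m pr)); first exact: eq_row_base.
  exact: row_base_free.
pose F := linfun (mulmxr M) : 'Hom('rV[R]_k, 'rV[R]_n).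
have memF (x : 'rV[R]_n) : (x \in limg F) = (x <= K *m pr)%MS.
  rewrite -ME; apply/memv_imgP/submxP => [[u _ ->]|[u ->]].
    by exists u; rewrite lfunE.
  by exists u; rewrite ?memvf// lfunE.
exists (val t0), (limg F); split.
  rewrite limg_dim_eq ?dimvf ?dim_matrix ?mul1r//.
  have /lker0P/eqP -> : injective F; last by rewrite capv0.
  by move=> u v; rewrite !lfunE /=; exact: row_free_inj.
have t0sp := mem_sp hpt t0A.
have subE y : row_mx (y - val t0) 0 = homog y - hpt t0.
  by rewrite /hpt /homog opp_row_mx add_row_mx subrr.
apply/seteqP; split=> y /=; rewrite memF.
  move=> /aff_hull_conv_hull yA.
  have : (row_mx (y - val t0) 0 <= K)%MS.
    rewrite sub_capmx subE addmx_sub ?eqmx_opp//=; apply/sub_kermxP.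
    by rewrite -subE /e /aff_form trmx0 oppr0 mul_row_col mulmx0 mul0mx addr0.
  by move=> /(submxMr pr); rewrite mul_row_col mulmx1 mul0mx addr0.
move=> /submxP[u uE]; apply/aff_hull_conv_hull.
rewrite -[homog y](subrK (hpt t0)) -subE addmx_sub// row0E uE -mulmxA KE//.
by rewrite mulmx_sub// capmxSl.
Qed.

Lemma has_dim_uniq (A : set 'rV[R]_n) k l : has_dim A k -> has_dim A l -> k = l.
Proof.
move=> [x [U [<- AU]]] [y [W [<- AW]]].
have UW z : (z - x \in U) = (z - y \in W).
  have := congr1 (@^~ z) (etrans (esym AU) AW); rewrite /= => E.
  by apply/idP/idP; rewrite E.
have xyW : x - y \in W by rewrite -UW subrr mem0v.
congr (\dim _); apply/vspaceP => u.
by rewrite -{1}(addrK x u) UW -addrA rpredDr.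
Qed.

(** Dimension is unique, and rank 0 is excluded because the affine hull contains its base point,
    whose homogenization is nonzero. *)
Lemma rk_has_dim (A : {set V}) k :
  has_dim (conv_hull (pts A)) k -> rk hpt A = k.+1.
Proof.
move=> Ak; case rkA: (rk hpt A) => [|m]; last first.
  by rewrite (has_dim_uniq Ak (has_dim_conv_hull rkA)).
have [x [U [_ AU]]] := Ak.
have : aff_hull (conv_hull (pts A)) x by rewrite AU /= subrr mem0v.
move=> /aff_hull_conv_hull; have /eqP := rkA.
rewrite mxrank_eq0 => /eqP ->; rewrite submx0 => /eqP.
rewrite -[0](@row_mx0 _ 1 n 1) => /eq_row_mx[_ /rowP/(_ 0)/eqP].
by rewrite !mxE oner_eq0.
Qed.

End Dimension.

(** * From polytopes to point configurations *)

Theorem theorem2 (R : realType) (n d : nat) (P : set 'rV[R]_n)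
    (hd : (1 <= d)%N) (hP : polytope P) (hdim : has_dim P d)
    (h2 : two_level P) :
  (num_vertices P * num_faces d.-1 P <= d * 2 ^ d.+1)%N.
Proof.
pose V := fset_set (vertices P).
have VE : [set` V] = vertices P by rewrite fset_setK//; exact: finite_vertices.
pose p := @hpt R n V.
have Vt (t : V) : vertices P (val t) by rewrite -VE; exact: valP.
have ptsT : pts [set: V] = vertices P.
  rewrite -VE; apply/seteqP; split=> [_ [t _ ->]|x xV]; first exact: valP.
  by exists [` xV]%fset; rewrite ?inE.
have PE : conv_hull (vertices P) = P := conv_hull_vertices hP.
have rkT : rk p [set: V] = d.+1 by apply: rk_has_dim; rewrite ptsT PE.
have nonnegP a b : nonneg p [set: V] (aff_form a b) <->
    P `<=` halfspace a b.
  split=> [ab|Pab t _]; last first.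
    by rewrite ev_hpt subr_ge0; apply: Pab; apply: vertices_sub.
  rewrite -PE; apply: conv_hull_halfspace; rewrite -ptsT => _ [t tT ->].
  by have := ab t tT; rewrite ev_hpt subr_ge0.
have zerosE a b : pts (zeros p [set: V] (aff_form a b)) =
    vertices P `&` hyperplane a b.
  rewrite -ptsT; apply/seteqP; split=> [_ [t + ->]|_ [[t _ ->] tab]].
    rewrite !inE ev_hpt subr_eq0 => /eqP tb.
    by split; [exists t; rewrite ?inE|rewrite /hyperplane /= tb].
  by exists t; rewrite // !inE ev_hpt subr_eq0 eq_sym; apply/eqP.
have faceE a b : P `<=` halfspace a b ->
    P `&` hyperplane a b =
    conv_hull (pts (zeros p [set: V] (aff_form a b))).
  move=> Pab; have : face (conv_hull (vertices P)) (P `&` hyperplane a b).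
    by rewrite PE; exists a, b.
  move=> /face_conv_hull FE; rewrite [LHS]FE zerosE; congr conv_hull.
  rewrite setIA; congr (_ `&` _).
  by apply/classical_sets.setIidPl; exact: vertices_sub.
have T2 : two_level_points p [set: V].
  move=> f [f0 rkf]; have [a [b fE]] := aff_formE f; subst f.
  have Pab : P `<=` halfspace a b by apply/nonnegP.
  have rkz : rk p (zeros p [set: V] (aff_form a b)) = d.
    by move: rkf; rewrite rkT => -[].
  (* A zero normal would make the form constant, with all points or none as zeros: rank [d.+1] or 0,
     neither of which is [d]. *)
  have a0 : a != 0.
    apply/eqP => a0; have dota x : dot a x = 0.
      by rewrite a0 /dot big1// => i _; rewrite mxE mul0r.
    have [b0|b0] := eqVneq b 0.
      suff zT : zeros p [set: V] (aff_form a b) = [set: V]%SET.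
        by move: rkz; rewrite zT rkT; lia.
      by apply/setP => t; rewrite !inE ev_hpt dota b0 subrr eqxx.
    suff z0 : zeros p [set: V] (aff_form a b) = finset.set0.
      by move: rkz hd; rewrite z0 /rk /sp big_set0 mxrank0 => <-.
    by apply/setP => t; rewrite !inE ev_hpt dota subr0 (negPf b0).
  have [|b' Pb'] := h2 a b a0.
    exists d.-1; first by rewrite prednK.
    split; first by exists a, b.
    by rewrite faceE//; apply: has_dim_conv_hull; rewrite prednK.
  exists (b - b') => t _; rewrite ev_hpt.
  by have [->|->] := Pb' _ (Vt t); [left; rewrite subrr|right].
(* Each counted face is the hull of the zeros of its form, and by rank this is a facet form; so the
   faces lie in the image of [facet_sets]. *)
have nf : (num_faces d.-1 P <= #|facet_sets p [set: V]|)%N.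
  pose F := [fset conv_hull (pts Z) | Z in facet_sets p [set: V]]%fset.
  have sub : faces d.-1 P `<=` [set` F].
    move=> G [[a [b [Pab GE]]] Gdim]; apply/imfsetP.
    exists (zeros p [set: V] (aff_form a b)); last by rewrite GE faceE.
    rewrite inE; apply/asboolP; exists (aff_form a b) => //.
    split; first exact/nonnegP.
    rewrite rkT -{1}(prednK hd); congr _.+1; apply/esym/rk_has_dim.
    by rewrite -faceE// -GE.
  apply: (@leq_trans #|` F|).
    apply: fsubset_leq_card; apply/fsubsetP => G.
    by rewrite in_fset_set ?inE => [/sub|]; last exact: finite_faces.
  by rewrite (leq_trans (leq_imfset_card _ _ _))// cardE.
have fb := facet_sets_bound (@ev_hpt1 R n V) (@hpt_inj R n V) T2 rkT hd.
rewrite (leq_trans _ fb)//.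
apply: leq_mul => //.
by rewrite cardsT -cardfE.
Qed.
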